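(* For every integer $n\ge 3$, $$\frac{(n-1)!}{2\cdot\lfloor n/2 \rfloor !\,(1+\sqrt{2})^n}\leq Q(n)\leq \frac{n!}{\lfloor n/2 \rfloor !\; 2^{\lfloor n/2 \rfloor}},$$ where $Q(n)$ is the largest cardinality of a family $\mathcal{G}$ of Hamilton cycles on the vertex set $[n]=\{1,\dots,n\}$ such that the union of any two different members of $\mathcal{G}$ has maximum degree at least $4$.
   Context: All graphs are finite, simple and undirected, with labelled vertex set $[n]=\{1,2,\dots,n\}$. A Hamilton cycle on $[n]$ is a connected graph with vertex set $[n]$ in which every vertex has degree exactly $2$; two Hamilton cycles are different if their edge sets are different. The union of two graphs on the same vertex set $[n]$ is the graph on $[n]$ whose edge set is the union of the two edge sets. A graph has maximum degree at least $4$ if some vertex has degree at least $4$. *)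

(* Defs.v *)
From mathcomp Require Import all_boot all_order all_algebra.

Set Implicit Arguments.
Unset Strict Implicit.
Unset Printing Implicit Defensive.

(* A graph on the labelled vertex set [n] is represented by its edge set, an  *)
(* edge being a set of vertices; 'I_n = {0, .., n-1} stands for {1, .., n}.   *)
(* Leibniz equality of graphs is therefore equality of edge sets, and the     *)
(* union of two graphs is E :|: F.                                            *)
Definition graph (n : nat) := {set {set 'I_n}}.

Definition simple_graph (n : nat) (E : graph n) : bool :=
  [forall e in E, #|e| == 2].

(* Loop-free on simple graphs: [set u; u] has one element.                    *)
Definition adj (n : nat) (E : graph n) : rel 'I_n :=
  fun u v => [set u; v] \in E.

Definition degree (n : nat) (E : graph n) (v : 'I_n) : nat :=
  #|[set w | adj E v w]|.

Definition connected_graph (n : nat) (E : graph n) : bool :=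
  [forall u, forall v, connect (adj E) u v].

Definition hamilton_cycle (n : nat) (E : graph n) : bool :=
  [&& simple_graph E, connected_graph E & [forall v, degree E v == 2]].

Definition max_degree_ge (n : nat) (d : nat) (E : graph n) : bool :=
  [exists v, d <= degree E v].

Definition admissible_family (n : nat) (G : {set graph n}) : bool :=
  [forall E in G, hamilton_cycle E] &&
  [forall E in G, forall F in G, (E != F) ==> max_degree_ge 4 (E :|: F)].

(* The maximum ranges over a nonempty finite set: set0 is admissible.         *)
Definition Q (n : nat) : nat :=
  \max_(G : {set graph n} | admissible_family G) #|G|.

(* Main.v *)
Require Import Defs.
From mathcomp Require Import all_boot all_order all_algebra zify.

Set Implicit Arguments.
Unset Strict Implicit.
Unset Printing Implicit Defensive.

(** Write m for n./2.  At every vertex two Hamilton cycles have two neighbours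
    each, so their union has maximum degree at most 3 exactly when they have a
    common neighbour at every vertex ([max_degree_common]).  Both bounds follow
    from this and from the count of the perfect matchings of 2k points,
    1 * 3 * ... * (2k-1) = (2k)! / (k! 2^k).

    Upper bound.  A Hamilton cycle, cut open into a Hamilton path, contains a
    perfect matching if n is even, and a perfect matching of the vertices other
    than a prescribed v if n is odd ([hamilton_pm]).  Two cycles which share
    that matching, and for odd n also a neighbour of v, have a common neighbour
    everywhere; so the members of an admissible family have different
    matchings, or different pairs of a matching and a neighbour of v.  There
    are n! / (m! 2^m) matchings if n is even and at most
    (n-1) (n-1)! / (m! 2^m) pairs if n is odd.

    Lower bound.  An admissible family of maximum size cannot be extended, so
    every Hamilton cycle has a common neighbour everywhere with some member E
    ([compatible_cover]).  There are at least (n-1)!/2 Hamilton cycles, because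
    a cyclic sequence from a fixed start is determined by its cycle and its
    first step.  It remains to show that at most m! (1 + sqrt 2)^n cycles F
    have a common neighbour everywhere with one E.  Let U be the set of vertices
    at which E and F have different neighbourhoods.  Then E \ F and F \ E are
    perfect matchings on U ([pm_diff]), and they determine F.  Connectivity of E
    leaves at most two choices for E \ F
    ([pm_of_hamilton]), hence, with |U| = 2k > 0, at most
    2 * 1 * 3 * ... * (2k-1) <= k! 2^k <= m! (sqrt 2)^|U| choices for F.
    Summing (sqrt 2)^|U| over all sets U of vertices gives (1 + sqrt 2)^n. *)

(** * Graphs through their neighbourhoods *)

Definition nbr (n : nat) (E : graph n) (v : 'I_n) : {set 'I_n} :=
  [set w | adj E v w].

Lemma in_nbr (n : nat) (E : graph n) (v w : 'I_n) :
  (w \in nbr E v) = ([set v; w] \in E).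
Proof. by rewrite inE. Qed.

Lemma nbr_sym (n : nat) (E : graph n) (v w : 'I_n) :
  (w \in nbr E v) = (v \in nbr E w).
Proof. by rewrite !in_nbr setUC. Qed.

Lemma adj_sym (n : nat) (E : graph n) : symmetric (adj E).
Proof. by move=> u v; rewrite /adj setUC. Qed.

Lemma nbrU (n : nat) (E F : graph n) (v : 'I_n) :
  nbr (E :|: F) v = nbr E v :|: nbr F v.
Proof. by apply/setP=> w; rewrite in_nbr !in_setU !in_nbr. Qed.

Lemma nbrD (n : nat) (E F : graph n) (v : 'I_n) :
  nbr (E :\: F) v = nbr E v :\: nbr F v.
Proof. by apply/setP=> w; rewrite in_nbr !in_setD !in_nbr. Qed.

Lemma nbr_subset (n : nat) (E F : graph n) (v : 'I_n) :
  E \subset F -> nbr E v \subset nbr F v.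
Proof. by move=> /subsetP EF; apply/subsetP=> w; rewrite !in_nbr => /EF. Qed.

Lemma nbr_irrefl (n : nat) (E : graph n) (v : 'I_n) :
  simple_graph E -> v \notin nbr E v.
Proof.
move=> /forall_inP simE; rewrite in_nbr setUid.
by apply/negP => /simE; rewrite cards1.
Qed.

Lemma simple_subset (n : nat) (E F : graph n) :
  E \subset F -> simple_graph F -> simple_graph E.
Proof.
by move=> /subsetP EF /forall_inP sF; apply/forall_inP=> e /EF /sF.
Qed.

Lemma simple_subset_nbr (n : nat) (E F : graph n) :
  simple_graph E -> (forall v, nbr E v \subset nbr F v) -> E \subset F.
Proof.
move=> /forall_inP simE EF; apply/subsetP=> e eE.
have /cards2P[u [v [_ e_uv]]] := simE e eE.
have : v \in nbr E u by rewrite in_nbr -e_uv.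
by move/(subsetP (EF u)); rewrite in_nbr -e_uv.
Qed.

Lemma simple_graph_ext (n : nat) (E F : graph n) :
  simple_graph E -> simple_graph F -> nbr E =1 nbr F -> E = F.
Proof.
move=> sE sF EF; apply/eqP; rewrite eqEsubset.
by rewrite !simple_subset_nbr // => v; rewrite EF.
Qed.

Lemma hamilton_simple (n : nat) (E : graph n) :
  hamilton_cycle E -> simple_graph E.
Proof. by case/and3P. Qed.

Lemma hamilton_degree (n : nat) (E : graph n) (v : 'I_n) :
  hamilton_cycle E -> #|nbr E v| = 2.
Proof. by case/and3P=> _ _ /forallP/(_ v)/eqP. Qed.

(** The form in which connectivity is used: a nonempty set of vertices closed
    under adjacency is everything. *)
Lemma hamilton_closed (n : nat) (E : graph n) (W : {set 'I_n}) (w : 'I_n) :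
    hamilton_cycle E -> w \in W ->
    (forall u v, v \in nbr E u -> u \in W -> v \in W) ->
  W = [set: 'I_n].
Proof.
case/and3P=> _ /forallP conE _ wW clW; apply/setP=> v; rewrite inE.
have cl: closed (adj E) (mem W).
  apply: (intro_closed (sym_connect_sym (@adj_sym n E))) => x y xy.
  by apply: clW; rewrite inE.
by rewrite -(closed_connect cl (forallP (conE w) v)).
Qed.

Lemma nbr2_eq (n : nat) (E : graph n) (v a b : 'I_n) :
    hamilton_cycle E -> a \in nbr E v -> b \in nbr E v -> a != b ->
  nbr E v = [set a; b].
Proof.
move=> hE va vb ab; apply/esym/eqP; rewrite eqEcard hamilton_degree // cards2 ab.
by rewrite andbT subUset !sub1set va.
Qed.

(** The union of two sets of size 2 has at most 3 elements exactly when the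
    sets meet. *)
Lemma max_degree_common (n : nat) (E F : graph n) :
    hamilton_cycle E -> hamilton_cycle F ->
  ~~ max_degree_ge 4 (E :|: F) = [forall v, nbr E v :&: nbr F v != set0].
Proof.
move=> hE hF; rewrite negb_exists; apply: eq_forallb => v.
rewrite -ltnNge /degree -/(nbr _ _) nbrU -card_gt0.
have := cardsUI (nbr E v) (nbr F v).
rewrite !hamilton_degree //; move: #|_ :|: _| #|_ :&: _| => j k; lia.
Qed.

(** * Perfect matchings on a set of vertices *)

(** Membership in U serves as the degree, so that the vertices outside U are
    isolated and all matchings live on the vertex set of the ambient graph. *)
Definition perfect_matchings (n : nat) (U : {set 'I_n}) : {set graph n} :=
  [set M : graph n |
    simple_graph M && [forall v, #|nbr M v| == (v \in U)]].

Lemma set2_eq (T : finType) (a b u v : T) :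
  ([set u; v] == [set a; b]) = (u == a) && (v == b) || (u == b) && (v == a).
Proof.
apply/eqP/idP=> [h | /orP[] /andP[/eqP-> /eqP->] //]; last by rewrite setUC.
have := set21 u v; have := set22 u v; rewrite h !inE.
have := set21 a b; have := set22 a b; rewrite -h {h} !inE.
rewrite [b == u]eq_sym [b == v]eq_sym [a == u]eq_sym [a == v]eq_sym.
by case: (u == a); case: (u == b); case: (v == a); case: (v == b).
Qed.

Lemma pmP (n : nat) (U : {set 'I_n}) (M : graph n) :
  reflect (simple_graph M /\ forall v, #|nbr M v| = (v \in U))
          (M \in perfect_matchings U).
Proof.
rewrite inE; apply: (iffP andP) => -[sM dM]; split=> //.
  by move=> v; apply/eqP/(forallP dM).
by apply/forallP=> v; apply/eqP.
Qed.

Lemma pm_mate (n : nat) (U : {set 'I_n}) (M : graph n) (v : 'I_n) :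
  M \in perfect_matchings U -> v \in U -> exists w, nbr M v = [set w].
Proof. by case/pmP=> _ /(_ v) dM vU; apply/cards1P; rewrite dM vU. Qed.

Lemma pm_out (n : nat) (U : {set 'I_n}) (M : graph n) (v w : 'I_n) :
  M \in perfect_matchings U -> w \in nbr M v -> v \in U.
Proof.
case/pmP=> _ /(_ v) + wv; rewrite (cardD1 w) wv; by case: (v \in U).
Qed.

Lemma nbr_edge (n : nat) (a b v w : 'I_n) :
  (w \in nbr [set [set a; b]] v) = (v == a) && (w == b) || (v == b) && (w == a).
Proof. by rewrite in_nbr inE set2_eq. Qed.

Lemma nbr_edge_l (n : nat) (a b : 'I_n) :
  a != b -> nbr [set [set a; b]] a = [set b].
Proof.
by move=> ab; apply/setP=> w; rewrite nbr_edge inE eqxx (negbTE ab) orbF.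
Qed.

Lemma nbr_edge_r (n : nat) (a b : 'I_n) :
  a != b -> nbr [set [set a; b]] b = [set a].
Proof. by rewrite setUC eq_sym; apply: nbr_edge_l. Qed.

Lemma nbr_edge_out (n : nat) (a b v : 'I_n) :
  v != a -> v != b -> nbr [set [set a; b]] v = set0.
Proof.
move=> va vb; apply/setP=> w.
by rewrite nbr_edge inE (negbTE va) (negbTE vb).
Qed.

Lemma pm_add_edge (n : nat) (U : {set 'I_n}) (M : graph n) (a b : 'I_n) :
    a != b -> a \notin U -> b \notin U -> M \in perfect_matchings U ->
  [set a; b] |: M \in perfect_matchings (a |: (b |: U)).
Proof.
move=> ab aU bU /pmP[/forall_inP sM dM]; apply/pmP; split.
  by apply/forall_inP=> e; rewrite !inE => /orP[/eqP->|/sM]; rewrite ?cards2 ?ab.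
have out v : v \notin U -> nbr M v = set0.
  by move=> vU; apply/eqP; rewrite -cards_eq0 dM (negbTE vU).
move=> v; rewrite nbrU !inE.
have [->|va] := eqVneq v a; first by rewrite nbr_edge_l // out // setU0 cards1.
have [->|vb] := eqVneq v b; first by rewrite nbr_edge_r // out // setU0 cards1.
by rewrite nbr_edge_out // set0U dM.
Qed.

Lemma pm_remove_edge (n : nat) (U : {set 'I_n}) (M : graph n) (a b : 'I_n) :
    M \in perfect_matchings U -> b \in nbr M a ->
  M :\ [set a; b] \in perfect_matchings (U :\ a :\ b).
Proof.
move=> MU ba; have /pmP[sM dM] := MU.
have ab : a != b by apply: contraTneq ba => <-; apply: nbr_irrefl.
have [c Nac] := pm_mate MU (pm_out MU ba).
have ? : b = c by apply/set1P; rewrite -Nac. subst c.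
have abn : a \in nbr M b by rewrite nbr_sym.
have [c Nbc] := pm_mate MU (pm_out MU abn).
have ? : a = c by apply/set1P; rewrite -Nbc. subst c.
apply/pmP; split; first exact: simple_subset (subsetDl _ _) sM.
move=> v; rewrite nbrD !inE.
have [->|vb] := eqVneq v b; first by rewrite nbr_edge_r // Nbc setDv cards0.
have [->|va] := eqVneq v a; first by rewrite nbr_edge_l // Nac setDv cards0.
by rewrite nbr_edge_out // setD0 dM.
Qed.

Lemma pm_set0 (n : nat) (M : graph n) :
  (M \in perfect_matchings set0) = (M == set0).
Proof.
apply/idP/eqP=> [/pmP[sM dM] | ->].
  apply: simple_graph_ext => // [|v]; first by apply/forall_inP=> e; rewrite inE.
  apply/eqP; have := dM v; rewrite inE => /eqP; rewrite cards_eq0 => /eqP->.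
  by apply/eqP/setP=> w; rewrite in_nbr !inE.
apply/pmP; split=> [|v]; first by apply/forall_inP=> e; rewrite inE.
by rewrite inE; apply/eqP; rewrite cards_eq0; apply/eqP/setP=> w; rewrite in_nbr !inE.
Qed.

(** The number of partitions of a j-element set into pairs: the double
    factorial (j-1)!! for even j, and 0 for odd j. *)
Fixpoint pairings (j : nat) : nat :=
  match j with 0 => 1 | 1 => 0 | i.+2 => i.+1 * pairings i end.

Lemma leq_card_bigcup (I T : finType) (A : {set I}) (B : I -> {set T}) :
  #|\bigcup_(i in A) B i| <= \sum_(i in A) #|B i|.
Proof.
elim/big_rec2: _ => [|i y x _ yx]; first by rewrite cards0.
by apply: leq_trans (leq_card_setU _ _) _; rewrite leq_add2l.
Qed.

(** A fixed x in U has |U| - 1 possible mates y, and removing the edge xy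
    leaves a perfect matching on the other vertices of U. *)
Lemma leq_card_perfect_matchings (n : nat) (U : {set 'I_n}) :
  #|perfect_matchings U| <= pairings #|U|.
Proof.
have [k] := ubnP #|U|; elim: k U => // k IHk U ltUk.
have [->|[x xU]] := set_0Vmem U.
  rewrite cards0 /= -(cards1 (@set0 {set 'I_n})); apply/subset_leq_card/subsetP.
  by move=> M; rewrite pm_set0 inE.
pose G y := [set [set x; y] |: M | M in perfect_matchings (U :\ x :\ y)].
have pmG : perfect_matchings U \subset \bigcup_(y in U :\ x) G y.
  apply/subsetP=> M MU; have [y Nxy] := pm_mate MU xU.
  have yx : y \in nbr M x by rewrite Nxy set11.
  apply/bigcupP; exists y.
    rewrite !inE (@pm_out _ _ M _ x) // ?andbT -1?nbr_sym //.
    by apply: contraTneq yx => ->; apply: nbr_irrefl; case/pmP: MU.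
  apply/imsetP; exists (M :\ [set x; y]); first exact: pm_remove_edge.
  by rewrite setD1K // -in_nbr.
apply: leq_trans (subset_leq_card pmG) _.
apply: leq_trans (leq_card_bigcup _ _) _.
have cU : #|U| = #|U :\ x|.+1 by rewrite (cardsD1 x) xU.
case cUx : #|U :\ x| => [|j].
  by rewrite big1 // => y; rewrite (cards0_eq cUx) inE.
rewrite cU cUx /= -cUx -sum_nat_const; apply: leq_sum => y yUx.
apply: leq_trans (leq_imset_card _ _) _.
have cUy : #|U :\ x :\ y| = j by have := cardsD1 y (U :\ x); rewrite yUx cUx => -[].
by rewrite -[in leqRHS]cUy; apply: IHk; rewrite cUy; lia.
Qed.

Lemma pairingsSS (j : nat) : pairings j.+2 = j.+1 * pairings j.
Proof. by []. Qed.

Lemma pairings_odd (k : nat) : pairings k.*2.+1 = 0.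
Proof. by elim: k => // k IHk; rewrite doubleS pairingsSS IHk muln0. Qed.

Lemma pairings_double (k : nat) : pairings k.*2 * (k`! * 2 ^ k) = (k.*2)`!.
Proof.
elim: k => // k IHk; rewrite doubleS pairingsSS !factS expnS -IHk -!muln2.
lia.
Qed.

(** The factor 2 absorbs the two possible matchings of [pm_of_hamilton]; the
    inequality is sharp at k = 1, where both sides are 2. *)
Lemma pairings_double_le (k : nat) : 0 < k -> 2 * pairings k.*2 <= k`! * 2 ^ k.
Proof.
elim: k => // -[|k] IHk _ //; rewrite doubleS pairingsSS factS expnS.
move: (IHk isT); move: (_`!) (2 ^ _) (pairings _) => f p a.
rewrite -muln2; nia.
Qed.

(** * Hamilton cycles as cyclic sequences *)

(** Every other edge of a path with an even number of vertices. *)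
Lemma pm_of_path (n : nat) (E : graph n) (k : nat) (s : seq 'I_n) :
    size s = k.*2 -> uniq s -> sorted (adj E) s ->
  exists2 M, M \in perfect_matchings [set x in s] & M \subset E.
Proof.
elim: k s => [|k IHk] [|a [|b s]] // => [_ _ _|]; last case=> sz_s.
  exists set0; last exact: sub0set.
  by rewrite (_ : [set x in _] = set0) ?pm_set0 //; apply/setP=> x; rewrite !inE.
rewrite /= inE negb_or -!andbA => /and4P[ab aS bS uS] /andP[Eab pS].
have [M MS ME] := IHk s sz_s uS (path_sorted pS).
exists ([set a; b] |: M); last by rewrite subUset sub1set ME andbT.
rewrite (_ : [set x in _] = a |: (b |: [set x in s])).
  by apply: pm_add_edge => //; rewrite inE.
by apply/setP=> x; rewrite !inE.
Qed.

(** Take a longest path.  All neighbours of its two ends lie on it, and an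
    inner vertex has no neighbours besides its two neighbours on the path; so
    its vertex set is closed under adjacency and the path visits every vertex.
    Its last vertex has a second neighbour, which cannot be an inner vertex and
    is therefore the first one. *)
Lemma hamilton_cycle_seq (n : nat) (E : graph n) (v : 'I_n) :
    hamilton_cycle E ->
  exists p, [/\ cycle (adj E) (v :: p), uniq (v :: p) & size (v :: p) = n].
Proof.
move=> hE; have sE := hamilton_simple hE.
pose P k := [exists s : k.-tuple 'I_n, uniq s && sorted (adj E) s].
have exP : exists k, P k by exists 1; apply/existsP; exists [tuple v].
have ubP k : P k -> k <= n.
  case/existsP=> s /andP[/card_uniqP us _]; rewrite -(size_tuple s) -us.
  by rewrite -[leqRHS]card_ord max_card.
have [k /existsP[s0 /andP[us ps]] kmax] := ex_maxnP exP ubP.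
have maxP s : uniq s -> sorted (adj E) s -> size s <= k.
  move=> u_s p_s; apply: kmax; apply/existsP.
  by exists (in_tuple s); rewrite u_s.
have {kmax} k_gt0 : 0 < k by apply: (maxP [:: v]).
have := size_tuple s0; move: (tval s0) us ps => {s0} s us ps sz_s.
case: s => [|x p] in us ps sz_s; first by rewrite -sz_s in k_gt0.
set s := x :: p in us ps sz_s.
(* A new neighbour of the first or the last vertex would extend the path. *)
have hd_closed y : y \in nbr E x -> y \in s.
  apply: contraLR => yS; apply/negP => xy.
  have: size (y :: s) <= k.
    apply: maxP; first by rewrite /= yS.
    by rewrite /= in ps *; rewrite ps andbT adj_sym; rewrite inE in xy.
  by rewrite /= -sz_s ltnn.
have tl_closed y : y \in nbr E (last x p) -> y \in s.
  apply: contraLR => yS; apply/negP => xy.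
  have: size (rcons s y) <= k.
    apply: maxP; first by rewrite rcons_uniq yS.
    by rewrite /= in ps *; rewrite rcons_path ps; rewrite inE in xy.
  by rewrite size_rcons -sz_s ltnn.
have consec i : i.+1 < k -> nth v s i.+1 \in nbr E (nth v s i).
  by rewrite -sz_s => ik; rewrite in_nbr; apply: (sortedP v ps).
have nth_inj i j : i < k -> j < k -> nth v s i = nth v s j -> i = j.
  by rewrite -sz_s => ik jk /eqP; rewrite nth_uniq // => /eqP.
(* The two path neighbours of an inner vertex exhaust its degree. *)
have inner i : i.+2 < k ->
    nbr E (nth v s i.+1) = [set nth v s i; nth v s i.+2].
  move=> ik; apply: nbr2_eq => //; last 1 first.
  - by apply/eqP => /nth_inj; lia.
  - by rewrite nbr_sym; apply: consec; lia.
  by apply: consec; lia.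
have lastE : last x p = nth v s k.-1 by rewrite -sz_s nth_last.
have all_s : [set y in s] = [set: 'I_n].
  apply: (@hamilton_closed _ E _ x) => // [|a b ab]; first by rewrite inE mem_head.
  rewrite !in_set => aS; have [i ik aE] := nthP v aS; rewrite sz_s in ik.
  case: i => [|i] in ik aE; first by apply: hd_closed; rewrite -[x]/(nth v s 0) aE.
  have [ik2|ik2] := ltnP i.+2 k.
    move: ab; rewrite -aE inner // in_set2.
    by case/orP=> /eqP->; apply: mem_nth; rewrite sz_s; lia.
  by apply: tl_closed; rewrite lastE (_ : k.-1 = i.+1) ?aE //; lia.
have allS y : y \in s by have := in_setT y; rewrite -all_s in_set.
have k_n : k = n.
  rewrite -sz_s -(card_uniqP us) -[RHS]card_ord; apply: eq_card => y.
  by rewrite allS.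
have cyc : cycle (adj E) s.
  rewrite /= rcons_path [path _ _ _]ps /= /adj -in_nbr.
  apply: contraT => xl.
  (* If the end is not joined to x, its only neighbour is its predecessor. *)
  have : nbr E (last x p) \subset [set nth v s k.-2].
    apply/subsetP=> y ly; have [j jk yE] := nthP v (allS y).
    rewrite sz_s in jk; case: j => [|j] in jk yE.
      by move: ly xl; rewrite -yE => ->.
    have jk1 : j.+1 <> k.-1.
      by move=> jk1; move: ly; rewrite lastE -jk1 yE (negbTE (nbr_irrefl _ _)).
    move: ly; rewrite nbr_sym -yE inner ?lastE ?inE; last by lia.
    by case/orP=> /eqP/nth_inj jk2; rewrite (_ : j.+1 = k.-2) ?eqxx //; lia.
  by move/subset_leq_card; rewrite hamilton_degree // cards1.
have [i q rot_s] := rot_to (allS v); exists q; rewrite -rot_s.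
by rewrite rot_cycle rot_uniq size_rot sz_s.
Qed.

(** In a graph of degree 2, a path that does not turn back has only one way to
    continue. *)
Lemma hamilton_path_determined (n : nat) (E : graph n) (v w : 'I_n)
    (p q : seq 'I_n) :
    hamilton_cycle E -> size p = size q ->
    path (adj E) v (w :: p) -> uniq [:: v, w & p] ->
    path (adj E) v (w :: q) -> uniq [:: v, w & q] ->
  p = q.
Proof.
move=> hE; elim: p q v w => [|a p IHp] [|b q] // v w [sz_pq].
move=> /andP[vw wap] /andP[v_p u_p] /andP[_ wbq] /andP[v_q u_q].
suff ab : a = b by rewrite -ab in wbq u_q *; rewrite (IHp q w a).
have va : v != a by apply: contraNneq v_p => ->; rewrite !inE eqxx orbT.
have vb : b != v by apply: contraNneq v_q => <-; rewrite !inE eqxx orbT.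
have wv : v \in nbr E w by rewrite nbr_sym inE.
have wa : a \in nbr E w by rewrite inE; case/andP: wap.
have : b \in nbr E w by rewrite inE; case/andP: wbq.
by rewrite (nbr2_eq hE wv wa va) in_set2 (negbTE vb) => /eqP.
Qed.

Lemma mem_uniq_full (n : nat) (s : seq 'I_n) :
  uniq s -> size s = n -> forall u, u \in s.
Proof.
move=> us sz_s u; have cs : #|s| = #|'I_n| by rewrite (card_uniqP us) card_ord.
by have /(subset_cardP cs)-> : s \subset 'I_n by apply: subset_predT.
Qed.

Definition cycle_graph (n : nat) (s : seq 'I_n) : graph n :=
  [set [set u; next s u] | u : 'I_n].

Lemma next_distinct (T : eqType) (s : seq T) (u : T) :
    uniq s -> 2 < size s -> u \in s ->
  (next s u != u) && (next s (next s u) != u).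
Proof.
move=> us sz_s uS; have [i q rot_s] := rot_to uS.
rewrite -!(next_rot i us) rot_s.
have : uniq (u :: q) by rewrite -rot_s rot_uniq.
have : size (u :: q) = size s by rewrite -rot_s size_rot.
case: q {rot_s} => [|a [|b q]]; rewrite /= => sz_q; [lia|lia|clear sz_q].
rewrite !inE !negb_or => /and3P[/and3P[ua ub _] _ _].
have [au bu] : (a == u) = false /\ (b == u) = false.
  by split; rewrite eq_sym; apply: negbTE.
by rewrite !(eqxx, au, bu).
Qed.

Lemma cycle_graph_next (n : nat) (s : seq 'I_n) (u : 'I_n) :
  next s u \in nbr (cycle_graph s) u.
Proof. by rewrite in_nbr; apply: imset_f. Qed.

Lemma cycle_cycle_graph (n : nat) (s : seq 'I_n) :
  uniq s -> cycle (adj (cycle_graph s)) s.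
Proof.
move=> us; apply: sub_cycle (cycle_next us) => u _ /eqP <-.
by rewrite -[adj _ _ _]in_set cycle_graph_next.
Qed.

Lemma nbr_cycle_graph (n : nat) (s : seq 'I_n) (u : 'I_n) :
  uniq s -> nbr (cycle_graph s) u = [set next s u; prev s u].
Proof.
move=> us; apply/setP=> w; rewrite in_set2; apply/idP/idP => [|/orP[]/eqP->].
- rewrite in_nbr => /imsetP[x _ /eqP]; rewrite set2_eq.
  case/orP=> /andP[/eqP-> /eqP->]; first by rewrite eqxx.
  by rewrite (prev_next us) eqxx orbT.
- exact: cycle_graph_next.
by rewrite nbr_sym -[X in X \in _](next_prev us) cycle_graph_next.
Qed.

Lemma hamilton_cycle_graph (n : nat) (s : seq 'I_n) :
  2 < n -> uniq s -> size s = n -> hamilton_cycle (cycle_graph s).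
Proof.
move=> n_gt2 us sz_s; have mem_s := mem_uniq_full us sz_s.
have dist u : (next s u != u) && (next s (next s u) != u).
  by apply: next_distinct; rewrite ?sz_s.
apply/and3P; split.
- apply/forall_inP=> e /imsetP[u _ ->]; rewrite cards2 [u == _]eq_sym.
  by case/andP: (dist u) => ->.
- by do 2!apply/forallP=> ?; apply: (connect_cycle (cycle_cycle_graph us)).
apply/forallP=> u; rewrite /degree -/(nbr _ _) nbr_cycle_graph // cards2.
have /andP[_] := dist (prev s u); rewrite next_prev // => /negbTE->; exact: isT.
Qed.

Definition hamilton_cycles (n : nat) : {set graph n} :=
  [set E | hamilton_cycle E].

(** There are (n-1)! sequences which list all vertices from a fixed v.  Each
    yields a Hamilton cycle, and those yielding the same cycle E are told apart
    by their second term, one of the two neighbours of v in E. *)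
Lemma fact_leq_hamilton_cycles (n : nat) :
  2 < n -> (n.-1)`! <= 2 * #|hamilton_cycles n|.
Proof.
case: n => [|[|k]] //; set n := k.+1; set m := n.+1; move=> m_gt2.
rewrite [m.-1]/=.
pose v : 'I_m := ord0.
pose T := [set t : n.-tuple 'I_m | all (predC1 v) t & uniq t].
have cT : #|T| = n`!.
  by rewrite card_uniq_tuples cardC1 card_ord ffactnn.
have TP (t : n.-tuple 'I_m) : t \in T -> uniq (v :: t) /\ size (v :: t) = m.
  rewrite inE => /andP[/allP vt ut]; rewrite /= size_tuple ut andbT; split=> //.
  by apply/negP=> /vt.
pose c (t : n.-tuple 'I_m) := cycle_graph (v :: t).
rewrite -cT -sum1_card (partition_big c (mem (hamilton_cycles m))) /=; last first.
  by move=> t /TP[ut sz_t]; rewrite inE hamilton_cycle_graph.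
rewrite mulnC -sum_nat_const; apply: leq_sum => E; rewrite inE => hE.
rewrite sum1_card -(hamilton_degree v hE).
pose F := [set t in T | c t == E].
have FP t : t \in F -> [/\ path (adj E) v t, uniq (v :: t) & size t = n].
  rewrite inE => /andP[/TP[ut _] /eqP ct]; rewrite ut size_tuple; split=> //.
  have := cycle_cycle_graph ut; rewrite -/(c t) ct /= rcons_path.
  by case/andP.
rewrite (_ : #|_| = #|F|); last by apply: eq_card => t; rewrite [RHS]inE.
rewrite -(@card_in_imset _ _ (fun t : n.-tuple 'I_m => head v t)).
  apply/subset_leq_card/subsetP=> _ /imsetP[t /FP[pt _ sz_t] ->].
  by case: (tval t) pt sz_t => [|a q /andP[va _] _] //; rewrite inE.
move=> t1 t2 /FP[p1 u1 s1] /FP[p2 u2 s2] eq12; apply/val_inj => /=.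
case: (tval t1) (tval t2) p1 u1 s1 p2 u2 s2 eq12 => [|a q1] [|b q2] //.
move=> p1 u1 [s1] p2 u2 [s2] /= ab; rewrite -ab in p2 u2 *.
by rewrite (hamilton_path_determined hE _ p1 u1 p2 u2) // s1 s2.
Qed.

(** * Upper bound *)

Lemma admissible_hamilton (n : nat) (G : {set graph n}) (E : graph n) :
  admissible_family G -> E \in G -> hamilton_cycle E.
Proof. by case/andP=> /forall_inP + _; apply. Qed.

Lemma admissible_eq (n : nat) (G : {set graph n}) (E F : graph n) :
    admissible_family G -> E \in G -> F \in G ->
    (forall v, exists w, (w \in nbr E v) && (w \in nbr F v)) ->
  E = F.
Proof.
move=> adG EG FG common; apply/eqP; apply: contraT => EF.
have [hE hF] := (admissible_hamilton adG EG, admissible_hamilton adG FG).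
case/andP: adG => _ /forall_inP/(_ E EG)/forall_inP/(_ F FG)/implyP/(_ EF).
apply: contraTT => _; rewrite max_degree_common //; apply/forallP=> v.
by have [w] := common v; rewrite -in_setI => wEF; apply/set0Pn; exists w.
Qed.

Lemma pm_common (n : nat) (U : {set 'I_n}) (M E F : graph n) (v : 'I_n) :
    M \in perfect_matchings U -> M \subset E -> M \subset F -> v \in U ->
  exists w, (w \in nbr E v) && (w \in nbr F v).
Proof.
move=> MU ME MF vU; have [w Mv] := pm_mate MU vU.
have wM : w \in nbr M v by rewrite Mv set11.
by exists w; rewrite (subsetP (nbr_subset v ME)) ?(subsetP (nbr_subset v MF)).
Qed.

(** Cutting the cycle open at v gives a path through all vertices; for odd n,
    dropping v makes the number of its vertices even. *)
Lemma hamilton_pm (n : nat) (E : graph n) (v : 'I_n) : hamilton_cycle E ->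
  exists2 M, M \in perfect_matchings (if odd n then [set~ v] else setT)
    & M \subset E.
Proof.
move=> hE; have [p [cp up sz_p]] := hamilton_cycle_seq v hE.
have pp : path (adj E) v p by move: cp; rewrite /= rcons_path => /andP[].
have allp := mem_uniq_full up sz_p.
have n_half := odd_double_half n; case: (odd n) n_half => n_half.
  have [||M MU ME] := pm_of_path _ _ (path_sorted pp) (k := n./2).
  - by move: sz_p; rewrite /= -[RHS]n_half => -[].
  - by case/andP: up.
  exists M => //; rewrite (_ : [set~ v] = [set x in p]) //.
  apply/setP=> x; rewrite in_setC1 in_set; case/andP: up => vp _.
  have [->|xv] := eqVneq x v; first by rewrite (negbTE vp).
  by have := allp x; rewrite in_cons (negbTE xv) /= => ->.
have [|M MU ME] := @pm_of_path _ E n./2 (v :: p) _ up pp.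
- by rewrite sz_p -[LHS]n_half.
exists M => //; rewrite (_ : setT = [set x in v :: p]) //.
by apply/setP=> x; rewrite !in_set allp.
Qed.

(** For odd n a shared matching gives a common neighbour everywhere but at v;
    recording also one neighbour of v, which is one of the n - 1 other
    vertices, makes the code injective on the family. *)
Lemma admissible_leq (n : nat) (G : {set graph n}) :
  0 < n -> admissible_family G -> #|G| * (n./2`! * 2 ^ n./2) <= n`!.
Proof.
case: n G => // n' G _ adG; set n := n'.+1; pose v : 'I_n := ord0.
pose U : {set 'I_n} := if odd n then [set~ v] else setT.
pose f (E : graph n) := odflt set0 [pick M in perfect_matchings U | M \subset E].
have fP E : E \in G -> f E \in perfect_matchings U /\ f E \subset E.
  move=> /(admissible_hamilton adG)/(hamilton_pm v)[M MU ME].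
  by rewrite /f; case: pickP => [N /andP[] //|/(_ M)]; rewrite [_ \in _]MU ME.
have n_half := odd_double_half n.
have [oddn|evenn] := boolP (odd n); last first.
  have UT : U = setT by rewrite /U (negbTE evenn).
  have cU : #|U| = n by rewrite UT cardsT card_ord.
  have inj_f : {in G &, injective f}.
    move=> E F EG FG eqf; apply: (admissible_eq adG EG FG) => u.
    have [fU fE] := fP E EG; have [_ fF] := fP F FG.
    apply: (pm_common fU fE); first by rewrite eqf.
    by rewrite UT inE.
  have : #|G| <= pairings n.
    rewrite -(card_in_imset inj_f) -[X in pairings X]cU.
    apply: leq_trans (leq_card_perfect_matchings U).
    apply/subset_leq_card/subsetP=> M.
    by case/imsetP=> E /fP[fU _] ->.
  rewrite -[in pairings n]n_half (negbTE evenn) add0n => leG.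
  rewrite -[in leqRHS]n_half (negbTE evenn) add0n -pairings_double.
  by rewrite leq_mul2r leG orbT.
pose g (E : graph n) := odflt v [pick w in nbr E v].
have gP E : E \in G -> g E \in nbr E v.
  move=> /(admissible_hamilton adG)/(hamilton_degree v) cE; rewrite /g.
  by case: pickP => [w //|nbr0]; rewrite (eq_card0 nbr0) in cE.
have UE : U = [set~ v] by rewrite /U oddn.
have cU : #|U| = n./2.*2.
  have := cardsC1 v; rewrite -UE card_ord => ->.
  by rewrite -[in LHS]n_half oddn.
have inj_fg : {in G &, injective (fun E => (f E, g E))}.
  move=> E F EG FG [eqf eqg]; apply: (admissible_eq adG EG FG) => u.
  have [fU fE] := fP E EG; have [_ fF] := fP F FG.
  have [->|uv] := eqVneq u v; first by exists (g E); rewrite gP // eqg gP.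
  by apply: (pm_common fU fE); rewrite ?eqf // UE !inE.
have : #|G| <= pairings #|U| * #|U|.
  rewrite -(card_in_imset inj_fg).
  apply: leq_trans (leq_mul (leq_card_perfect_matchings U) (leqnn _)).
  rewrite -cardsX; apply/subset_leq_card/subsetP=> _ /imsetP[E EG ->].
  have [fU _] := fP E EG; rewrite in_setX fU UE !inE.
  apply: contraTneq (gP E EG) => ->.
  by apply/nbr_irrefl/hamilton_simple/(admissible_hamilton adG).
rewrite cU -(leq_pmul2r (_ : 0 < n./2`! * 2 ^ n./2)); last first.
  by rewrite muln_gt0 fact_gt0 expn_gt0.
rewrite mulnAC pairings_double => /leq_trans; apply.
rewrite -[in leqRHS]n_half oddn add1n factS mulnC leq_mul2r leqnSn.
by rewrite orbT.
Qed.

(** * Lower bound *)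

Definition compatible (n : nat) (E : graph n) : {set graph n} :=
  [set F in hamilton_cycles n | ~~ max_degree_ge 4 (E :|: F)].

Definition nbr_diff (n : nat) (E F : graph n) : {set 'I_n} :=
  [set v | nbr E v != nbr F v].

(** At each vertex E and F share at least one of two neighbours, hence both or
    exactly one. *)
Lemma pm_diff (n : nat) (E F : graph n) :
    hamilton_cycle E -> hamilton_cycle F -> ~~ max_degree_ge 4 (E :|: F) ->
  E :\: F \in perfect_matchings (nbr_diff E F).
Proof.
move=> hE hF; rewrite max_degree_common // => /forallP common.
apply/pmP; split; first exact: simple_subset (subsetDl _ _) (hamilton_simple hE).
move=> v; rewrite nbrD in_set; have := common v; rewrite -card_gt0.
have := cardsID (nbr F v) (nbr E v); rewrite hamilton_degree //.
have [->|neqEF] := eqVneq (nbr E v) (nbr F v); first by rewrite setDv cards0.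
have : nbr E v :\: nbr F v != set0.
  apply: contra neqEF; rewrite setD_eq0 => EF.
  by rewrite eqEcard EF !hamilton_degree.
rewrite -card_gt0; move: #|_ :&: _| #|_ :\: _| => j k /=; lia.
Qed.

(** At a vertex v where D1 and D2 differ, the two edges of E at v are the D1
    edge and the D2 edge of v, so the neighbours of v are vertices where they
    differ as well.  By connectivity D1 and D2 differ nowhere or everywhere;
    in the second case they split E into two complementary matchings. *)
Lemma pm_of_hamilton (n : nat) (E D1 D2 : graph n) (U : {set 'I_n}) :
    hamilton_cycle E ->
    D1 \in perfect_matchings U -> D2 \in perfect_matchings U ->
    D1 \subset E -> D2 \subset E ->
  D2 = D1 \/ D2 = E :\: D1.
Proof.
move=> hE D1U D2U D1E D2E.
have [[sD1 dD1] [sD2 dD2]] := (pmP _ _ D1U, pmP _ _ D2U).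
have split_nbr v : v \in nbr_diff D1 D2 ->
    exists a b, [/\ a != b, nbr D1 v = [set a], nbr D2 v = [set b]
                  & nbr E v = [set a; b]].
  rewrite in_set => neq12; have vU : v \in U.
    apply: contraT => vU; move: (dD1 v) (dD2 v) neq12; rewrite (negbTE vU).
    by move=> /cards0_eq-> /cards0_eq->; rewrite eqxx.
  have [[a Da] [b Db]] := (pm_mate D1U vU, pm_mate D2U vU).
  have ab : a != b by apply: contraNneq neq12 => ab; rewrite Da Db ab.
  exists a, b; split=> //; apply: nbr2_eq => //.
    by apply: (subsetP (nbr_subset v D1E)); rewrite Da set11.
  by apply: (subsetP (nbr_subset v D2E)); rewrite Db set11.
have [W0|[w wW]] := set_0Vmem (nbr_diff D1 D2).
  left; apply: simple_graph_ext => // v; apply/esym/eqP; apply: contraT => vW.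
  by have := in_set0 v; rewrite -W0 in_set vW.
right; have WT : nbr_diff D1 D2 = setT.
  apply: (hamilton_closed hE wW) => u v uv /split_nbr[a [b [ab D1u D2u Eu]]].
  apply: contraT; rewrite in_set negbK => /eqP eqv.
  have : (u \in nbr D1 v) = (u \in nbr D2 v) by rewrite eqv.
  rewrite -!(nbr_sym _ u) D1u D2u !in_set1.
  move: uv; rewrite Eu in_set2.
  by case/orP=> /eqP->; rewrite eqxx ?(negbTE ab) // eq_sym (negbTE ab).
apply: simple_graph_ext => // [|v].
  exact: simple_subset (subsetDl _ _) (hamilton_simple hE).
have [a [b [ab D1v D2v Ev]]] : exists a b, [/\ a != b, nbr D1 v = [set a],
    nbr D2 v = [set b] & nbr E v = [set a; b]] by apply: split_nbr; rewrite WT.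
rewrite nbrD D1v D2v Ev; apply/setP=> x; rewrite in_setD in_set2 !in_set1.
by have [->|] := eqVneq x a; rewrite ?(negbTE ab).
Qed.

(** F is recovered from the matchings E \ F and F \ E on U.  There are at most
    two of the former, none if |U| is odd, and at most one if U is empty, where
    two would be too many for the claimed bound 1. *)
Lemma leq_card_compatible_nbr_diff (n : nat) (E : graph n) (U : {set 'I_n}) :
    hamilton_cycle E ->
  #|[set F in compatible E | nbr_diff E F == U]|
    <= ~~ odd #|U| * (#|U|./2`! * 2 ^ #|U|./2).
Proof.
move=> hE; set C := [set F in _ | _].
pose P := [set D in perfect_matchings U | D \subset E].
have CP F : F \in C -> (E :\: F \in P) && (F :\: E \in perfect_matchings U).
  rewrite in_set => /andP[+ /eqP mU]; rewrite in_set => /andP[+ EF].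
  rewrite in_set => hF; rewrite in_set -mU pm_diff // subsetDl /=.
  rewrite (_ : nbr_diff E F = nbr_diff F E); last first.
    by apply/setP=> v; rewrite !in_set eq_sym.
  by rewrite pm_diff // setUC.
have inj_C : {in C &, injective (fun F => (E :\: F, F :\: E))}.
  have recover (F : graph n) : E :\: (E :\: F) :|: F :\: E = F.
    apply/setP=> e; rewrite in_setU !in_setD.
    by case: (e \in E); case: (e \in F).
  by move=> F1 F2 _ _ [eqD eqM]; rewrite -(recover F1) eqD eqM recover.
have cC : #|C| <= #|P| * #|perfect_matchings U|.
  rewrite -cardsX -(card_in_imset inj_C); apply/subset_leq_card/subsetP=> X.
  by case/imsetP=> F /CP ? ->; rewrite in_setX.
have cP1 : #|P| <= #|perfect_matchings U|.
  by apply/subset_leq_card/subsetP=> D; rewrite in_set => /andP[].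
have cP2 : #|P| <= 2.
  have [->|[D0]] := set_0Vmem P; first by rewrite cards0.
  rewrite in_set => /andP[D0U D0E].
  apply: leq_trans (_ : #|[set D0; E :\: D0]| <= 2); last first.
    by rewrite cards2; case: (_ != _).
  apply/subset_leq_card/subsetP=> D; rewrite in_set => /andP[DU DE].
  have [->|->] := pm_of_hamilton hE D0U DU D0E DE; by rewrite !inE eqxx ?orbT.
have := leq_card_perfect_matchings U; have := odd_double_half #|U|.
case: (odd _) => /= U2 cU.
  by move: cU; rewrite -U2 pairings_odd leqn0 => /eqP cU; rewrite cU muln0 in cC.
rewrite mul1n; apply: leq_trans cC _; rewrite -[in X in _ <= X]U2 add0n in cU.
have [U0|U_gt0] := posnP #|U|./2.
  by rewrite U0 /= in cU *; apply: (leq_mul (leq_trans cP1 cU) cU).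
apply: leq_trans (pairings_double_le U_gt0).
by apply: leq_mul.
Qed.

Lemma admissible_maximal (n : nat) :
  exists2 G : {set graph n}, admissible_family G & #|G| = Q n.
Proof.
have ad0 : admissible_family (set0 : {set graph n}).
  by apply/andP; split; apply/forall_inP=> E; rewrite in_set0.
have [|G adG QE] := @eq_bigmax_cond _ (@admissible_family n) (fun G => #|G|).
  by apply/card_gt0P; exists set0.
by exists G.
Qed.

(** A Hamilton cycle compatible with no member of G could be added to G, which
    would then exceed the maximum size. *)
Lemma compatible_cover (n : nat) (G : {set graph n}) :
    admissible_family G -> #|G| = Q n ->
  hamilton_cycles n \subset \bigcup_(E in G) compatible E.
Proof.
move=> adG GQ; apply/subsetP=> F; rewrite in_set => hF; apply: contraT => FG.
have far E : E \in G -> max_degree_ge 4 (E :|: F).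
  move=> EG; apply: contraNT FG => EF; apply/bigcupP; exists E => //.
  by rewrite !in_set hF.
have FnG : F \notin G.
  apply: contra FG => FG; apply/bigcupP; exists F => //; rewrite !in_set hF.
  rewrite max_degree_common //; apply/forallP=> v; rewrite setIid -card_gt0.
  by rewrite hamilton_degree.
suff : #|F |: G| <= Q n by rewrite cardsU1 FnG GQ ltnn.
apply: (@leq_bigmax_cond _ _ (fun G : {set graph n} => #|G|)).
case/andP: (adG) => _ adG2; apply/andP; split.
  apply/forall_inP=> E; rewrite in_setU1 => /orP[/eqP-> //|].
  exact: admissible_hamilton.
apply/forall_inP=> E1 E1G; apply/forall_inP=> E2 E2G; apply/implyP => E12.
move: E1G E2G; rewrite !in_setU1.
case/orP=> [/eqP E1F|E1G] /orP[/eqP E2F|E2G].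
- by rewrite E1F E2F eqxx in E12.
- by rewrite E1F setUC far.
- by rewrite E2F far.
by have /forall_inP/(_ _ E1G)/forall_inP/(_ _ E2G)/implyP := adG2; apply.
Qed.

Import Order.TTheory GRing.Theory Num.Theory.
Local Open Scope ring_scope.

Lemma expr_1D_sum (R : comPzRingType) (n : nat) (x : R) :
  (1 + x) ^+ n = \sum_(U : {set 'I_n}) x ^+ #|U|.
Proof.
rewrite addrC -{1}[n]card_ord -prodr_const.
rewrite (@bigA_distr _ 0 1 _ _ _ (fun=> x) (fun=> 1)); apply: eq_bigr => U _.
by rewrite -big_mkcond prodr_const.
Qed.

(** The cycles F are sorted by the set U of vertices at which they differ from
    E; (1 + sqrt 2)^n is the total weight of all sets U, each of weight
    (sqrt 2)^|U|. *)
Lemma card_compatible_le (R : rcfType) (n : nat) (E : graph n) :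
    hamilton_cycle E ->
  #|compatible E|%:R <= (n./2`!)%:R * (1 + Num.sqrt 2) ^+ n :> R.
Proof.
move=> hE; rewrite expr_1D_sum mulr_sumr.
rewrite -sum1_card (partition_big (nbr_diff E) predT) //= natr_sum.
apply: ler_sum => U _; rewrite sum1_card.
rewrite (_ : #|_| = #|[set F in compatible E | nbr_diff E F == U]|); last first.
  by apply: eq_card => F; rewrite [RHS]in_set.
have := leq_card_compatible_nbr_diff U hE; rewrite -(ler_nat R) => /le_trans; apply.
case: (boolP (odd #|U|)) => [oddU|evenU].
  by rewrite mul0n mulr_ge0 ?ler0n ?exprn_ge0 ?sqrtr_ge0.
rewrite mul1n natrM natrX.
have {3}<- : (2 * #|U|./2)%N = #|U|.
  by rewrite mul2n -[RHS]odd_double_half (negbTE evenU).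
rewrite exprM sqr_sqrtr ?ler0n // ler_wpM2r ?exprn_ge0 ?ler0n // ler_nat.
by apply/leq_fact/half_leq; rewrite -[leqRHS]card_ord max_card.
Qed.

Theorem theorem1 (R : rcfType) (n : nat) (hn : (3 <= n)%N) :
  ((n.-1)`!)%:R / (2 * ((n./2)`!)%:R * (1 + Num.sqrt 2) ^+ n) <= (Q n)%:R :> R
  /\ (Q n)%:R <= (n`!)%:R / (((n./2)`!)%:R * 2 ^+ n./2) :> R.
Proof.
have [G adG GQ] := admissible_maximal n; have fact_pos k : 0 < (k`!)%:R :> R.
  by rewrite ltr0n fact_gt0.
split.
  rewrite ler_pdivrMr; last first.
    by rewrite !mulr_gt0 ?exprn_gt0 ?ltr_pwDl ?sqrtr_ge0 ?ltr01.
  have := fact_leq_hamilton_cycles hn; rewrite -(ler_nat R) => /le_trans; apply.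
  rewrite natrM -GQ -!mulrA [leRHS]mulrCA ler_wpM2l ?ler0n //.
  have := leq_trans (subset_leq_card (compatible_cover adG GQ))
                    (leq_card_bigcup _ _).
  rewrite -(ler_nat R) => /le_trans; apply.
  rewrite natr_sum [leRHS]mulr_natl -sumr_const; apply: ler_sum => E EG.
  exact/card_compatible_le/(admissible_hamilton adG).
rewrite ler_pdivlMr ?mulr_gt0 ?exprn_gt0 ?fact_pos ?ltr0n //.
by rewrite -natrX -!natrM ler_nat -GQ admissible_leq // (leq_trans _ hn).
Qed.
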